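(* Let $m\in\mathbb{N}$. The maximal sum $S_{m,\lfloor (m-1)/2\rfloor}$, that is, the largest of the sums $S_{m,\ell}$ for fixed $m$ and $0\le \ell\le \lfloor (m-1)/2\rfloor$, is strictly less than $1$. When the first index is even, written as $2m$ with $m\in\mathbb{N}$, the maximal sum is $S_{2m,m-1}$ and it is given by $$T(m) := S_{2m,m-1} = \sum_{r=2}^{m+1}\binom{2r}{r}\binom{m+1}{r}\frac{r-1}{2^{r}\binom{4m}{r}}.$$ A similar expression exists for the maximal sum when the first index is odd.
   Context: For $m\in\mathbb{N}$ and integers $0\le \ell\le \lfloor (m-1)/2\rfloor$, define $$S_{m,\ell} = \sum_{k=\ell}^{2\ell}\binom{m-\ell}{m-k}\binom{m+k}{2k}\binom{2m}{2k}^{-1}\cdot\frac{2\ell+1-k}{2^{m-k}}.$$ *)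

(* Defs.v *)
From mathcomp Require Import all_boot all_order all_algebra.

Set Implicit Arguments.
Unset Strict Implicit.
Unset Printing Implicit Defensive.

Import Order.TTheory GRing.Theory Num.Theory.
Local Open Scope ring_scope.

(* Only meaningful for 0 < m and l <= (m - 1) %/ 2.  In that range
   k <= 2 * l < m, so none of the natural-number subtractions is truncated
   and the binomial 'C(2 * m, 2 * k) is nonzero. *)
Definition Ssum (m l : nat) : rat :=
  \sum_(l <= k < (2 * l).+1)
    ('C(m - l, m - k))%:R * ('C(m + k, 2 * k))%:R * ('C(2 * m, 2 * k))%:R^-1
      * ((2 * l + 1 - k)%:R / 2%:R ^+ (m - k)).

Definition is_maximal_sum (m : nat) (x : rat) : Prop :=
  (exists2 l : nat, (l <= (m - 1) %/ 2)%N & x = Ssum m l) /\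
  (forall l : nat, (l <= (m - 1) %/ 2)%N -> Ssum m l <= x).

Definition Tsum (m : nat) : rat := Ssum (2 * m) (m - 1).

(* Main.v *)
Require Import Defs.
From mathcomp Require Import all_boot all_order all_algebra.
From mathcomp Require Import zify ring lra.

(** With r = m - k and n = m - l, the summand of S(m, l) is
    C(n, r) C(2r, r) / (2^r C(2m, r)) * (r - (2n - m - 1)).  Passing from l to
    l - 1 replaces (n, r) by (n + 1, r + 2) at equal weight, and multiplies the
    rest of the summand by
      (n + 1) (n - r) (2r + 1) (2r + 3)
        / ((r + 1) (r + 2) (2m - r) (2m - r - 1)) <= 1,
    so S(m, l) increases with l term by term.  For the largest l, the ratio
    C(n, r) / C(2m, r) is at most a constant times 4^-r, and the resulting sums
    of r C(2r, r) / 8^r and (r - 1) C(2r, r) / 8^r are bounded by telescoping. *)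

Import Order.TTheory GRing.Theory Num.Theory.
Local Open Scope ring_scope.

(** * Binomial identities and recurrences *)

Lemma mul_bin_trinomial a b c :
  ('C(a + b, a) * 'C(a + b + c, c) = 'C(b + c, c) * 'C(a + b + c, a))%N.
Proof.
(* Both sides are the trinomial coefficient (a + b + c)! / (a! b! c!), so it suffices to compare
   them after multiplying by a! b! c!. *)
have f_gt0 : (0 < a`! * b`! * c`!)%N by rewrite !muln_gt0 !fact_gt0.
apply/eqP; rewrite -(eqn_pmul2r f_gt0); apply/eqP.
have ab := bin_fact (leq_addr b a).
have abc := bin_fact (leq_addl (a + b) c).
have bc := bin_fact (leq_addl b c).
have le_a : (a <= a + b + c)%N by rewrite -addnA leq_addr.
have aN := bin_fact le_a.
have e1 : (a + b - a = b)%N by lia.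
have e2 : (a + b + c - c = a + b)%N by lia.
have e3 : (b + c - c = b)%N by lia.
have e4 : (a + b + c - a = b + c)%N by lia.
rewrite {}e1 in ab; rewrite {}e2 -ab in abc.
rewrite {}e3 in bc; rewrite {}e4 -bc -abc in aN.
nia.
Qed.

Lemma central_binS r :
  (r.+1 * 'C(2 * r.+1, r.+1) = 2 * (2 * r).+1 * 'C(2 * r, r))%N.
Proof.
have d := mul_bin_diag (2 * r).+2 r; have w := mul_bin_down (2 * r).+1 r.
have e : ((2 * r).+1 - r = r.+1)%N by lia.
rewrite /= {}e in w; rewrite /= in d.
have -> : (2 * r.+1 = (2 * r).+2)%N by lia.
by rewrite -d -mulnA w; lia.
Qed.

Lemma central_binSE r :
  ('C(2 * r.+1, r.+1))%:R
    = 2%:R * (2%:R * r%:R + 1) / (r%:R + 1) * ('C(2 * r, r))%:R :> rat.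
Proof.
have := congr1 (fun x => x%:R : rat) (central_binS r).
rewrite !natrM -[(2 * r).+1]addn1 -[in X in X = _]natr1 natrD natrM => E.
have r1 : r%:R + 1 != 0 :> rat by rewrite natr1 pnatr_eq0.
by apply: (mulfI r1); rewrite E; field.
Qed.

Lemma binSE n r :
  ('C(n, r.+1))%:R = (n - r)%:R * ('C(n, r))%:R / r.+1%:R :> rat.
Proof. by rewrite -natrM -mul_bin_left natrM mulrC mulKf // pnatr_eq0. Qed.

Lemma binSSE n r :
  ('C(n.+1, r.+1))%:R = n.+1%:R * ('C(n, r))%:R / r.+1%:R :> rat.
Proof. by rewrite -natrM mul_bin_diag natrM mulrC mulKf // pnatr_eq0. Qed.

(** * Geometric decay of C(n, r) / C(N, r) *)

Definition bin_ratio (n N r : nat) : rat := ('C(n, r))%:R / ('C(N, r))%:R.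

Lemma bin_ratio0 n N : bin_ratio n N 0 = 1.
Proof. by rewrite /bin_ratio !bin0 divr1. Qed.

Lemma bin_ratio_ge0 n N r : 0 <= bin_ratio n N r.
Proof. by rewrite divr_ge0. Qed.

Lemma bin_ratioS n N r : (r < N)%N ->
  bin_ratio n N r.+1 = bin_ratio n N r * ((n - r)%:R / (N - r)%:R).
Proof.
move=> lt_rN; rewrite /bin_ratio !binSE.
have N0 : (N - r)%:R != 0 :> rat by rewrite pnatr_eq0 subn_eq0 -ltnNge.
have B0 : ('C(N, r))%:R != 0 :> rat by rewrite pnatr_eq0 -lt0n bin_gt0 ltnW.
by field; rewrite N0 B0 nat1r pnatr_eq0.
Qed.

(** Each step multiplies the ratio by (n - r) / (N - r), which is at most 1/4 once 4 n <= N + 3 r;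
    the hypothesis says this at [r0], hence it holds from there on. *)
Lemma bin_ratio_le (n N r0 : nat) (K : rat) :
  (4 * n <= N + 3 * r0)%N -> bin_ratio n N r0 <= K / 4%:R ^+ r0 ->
  forall r, (r0 <= r <= N)%N -> bin_ratio n N r <= K / 4%:R ^+ r.
Proof.
move=> le_nN base r /andP[]; elim: r => [|r IHr].
  move=> le0 _; have r00 : r0 = 0%N by lia.
  by rewrite r00 in base.
move=> le_r0 le_rN; have [-> //|ne_r] := eqVneq r.+1 r0.
rewrite bin_ratioS // exprSr invfM [K * _]mulrA.
apply: ler_pM; rewrite ?bin_ratio_ge0 ?divr_ge0 //; first by apply: IHr; lia.
rewrite ler_pdivrMr ?ltr0n ?subn_gt0 // mulrC ler_pdivlMr // -natrM ler_nat.
lia.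
Qed.

(** * The sum in the variables r = m - k and n = m - l *)

Definition sum_term (m n r : nat) : rat :=
  ('C(2 * r, r))%:R / 2%:R ^+ r * bin_ratio n (2 * m) r.

Lemma sum_term_ge0 m n r : 0 <= sum_term m n r.
Proof. by rewrite mulr_ge0 ?bin_ratio_ge0 ?divr_ge0 ?exprn_ge0. Qed.

(* Reindexed by k = 2 * l - i, that is m - k = m - 2 * l + i. *)
Lemma SsumE m l : (2 * l < m)%N ->
  Ssum m l = \sum_(i < l.+1) sum_term m (m - l) (m - 2 * l + i) * i.+1%:R.
Proof.
move=> lt_lm; rewrite /Ssum -{1}[l]addn0 addnC big_addn.
have -> : ((2 * l).+1 - l = l.+1)%N by lia.
rewrite big_mkord (reindex_inj rev_ord_inj) /=; apply: eq_bigr => -[i lt_il] _ /=.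
set k := (_ + l)%N; set r := (_ + i)%N.
have -> : (m - k = r)%N by rewrite /k /r; lia.
have -> : (2 * l + 1 - k = i.+1)%N by rewrite /k; lia.
have mE : (k + r = m)%N by rewrite /k /r; lia.
(* This reads C(m + k, 2k) C(2m, r) = C(2r, r) C(2m, 2k), which trades the denominator C(2m, 2k) for
   C(2m, r). *)
have T := congr1 (fun x => x%:R : rat) (mul_bin_trinomial (2 * k) r r).
have e1 : (2 * k + r = m + k)%N by lia.
have e2 : (m + k + r = 2 * m)%N by lia.
have e3 : (r + r = 2 * r)%N by lia.
rewrite /= {}e1 {}e2 {}e3 !natrM in T.
have B1 : ('C(2 * m, 2 * k))%:R != 0 :> rat.
  by rewrite pnatr_eq0 -lt0n bin_gt0 -mE; lia.
have B2 : ('C(2 * m, r))%:R != 0 :> rat.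
  by rewrite pnatr_eq0 -lt0n bin_gt0 -mE; lia.
have -> : ('C(m + k, 2 * k))%:R
    = ('C(2 * r, r))%:R * ('C(2 * m, 2 * k))%:R / ('C(2 * m, r))%:R :> rat.
  by rewrite -T mulfK.
rewrite /sum_term /bin_ratio.
have P0 : 2%:R ^+ r != 0 :> rat by rewrite expf_neq0.
move: (2%:R ^+ r) P0 => P P0; by field; rewrite P0 B1 B2.
Qed.

(** * Monotonicity in l *)

Lemma sum_term_shift m n r : (n < m)%N ->
  sum_term m n.+1 r.+2 <= sum_term m n r.
Proof.
(* For n < r the left side vanishes, since C(n + 1, r + 2) = 0. *)
move=> lt_nm; have [lt_nr|le_rn] := ltnP n r.
  rewrite [leLHS]/sum_term /bin_ratio ['C(n.+1, _)]bin_small; last lia.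
  by rewrite mul0r mulr0 sum_term_ge0.
have B0 : ('C(2 * m, r))%:R != 0 :> rat.
  by rewrite pnatr_eq0 -lt0n bin_gt0; lia.
have P0 : 2%:R ^+ r != 0 :> rat by rewrite expf_neq0.
pose c : rat := n.+1%:R * (n - r)%:R * ((2 * r).+1%:R * (2 * r).+3%:R)
  / ((r.+1 * r.+2)%:R * ((2 * m - r)%:R * (2 * m - r.+1)%:R)).
have c_le1 : c <= 1.
  rewrite /c -!natrM ler_pdivrMr ?mul1r ?ler_nat ?ltr0n; last first.
    by rewrite !muln_gt0 /=; lia.
  (* Writing m and n through the gaps [d] and [e] removes truncated subtraction. Then c <= 1 splits
     into (2r + 1)(2r + 3) <= 4 (r + 1)(r + 2) and 4 (n + 1)(n - r) <= (2m - r)(2m - r - 1). *)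
  have [d dE] : exists d, m = (n.+1 + d)%N by exists (m - n.+1)%N; lia.
  have [e eE] : exists e, n = (r + e)%N by exists (n - r)%N; lia.
  have -> : (2 * m - r = r + 2 * e + 2 * d + 2)%N by lia.
  have -> : (2 * m - r.+1 = r + 2 * e + 2 * d + 1)%N by lia.
  have -> : (n - r = e)%N by lia.
  have le1 : ((2 * r).+1 * (2 * r).+3 <= 4 * (r.+1 * r.+2))%N by nia.
  have le2 : (4 * (n.+1 * e) <= (r + 2 * e + 2 * d + 2) * (r + 2 * e + 2 * d + 1))%N.
    by nia.
  have := leq_mul le1 le2; nia.
suff -> : sum_term m n.+1 r.+2 = c * sum_term m n r by rewrite ler_piMl ?sum_term_ge0.
rewrite /c /sum_term /bin_ratio !central_binSE binSSE !binSE.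
have M1 : (2 * m - r)%:R != 0 :> rat by rewrite pnatr_eq0; lia.
have M2 : (2 * m - r.+1)%:R != 0 :> rat by rewrite pnatr_eq0; lia.
move: (2 * m - r)%:R M1 (2 * m - r.+1)%:R M2 => M1 nzM1 M2 nzM2.
move: ('C(2 * m, r))%:R B0 => B nzB.
rewrite 2!exprS; move: (2%:R ^+ r) P0 => P nzP.
by field; rewrite nzB nzP nzM2 nzM1 -natrD nat1r !pnatr_eq0.
Qed.

Lemma Ssum_leS m l : (2 * l.+1 < m)%N -> Ssum m l <= Ssum m l.+1.
Proof.
move=> lt_lm; rewrite !SsumE //; last by lia.
(* The sum for l + 1 has one more term, which is nonnegative; the others are compared at equal
   [i]. *)
rewrite [leRHS]big_ord_recr /=; apply: ler_wpDr.
  by rewrite mulr_ge0 ?sum_term_ge0.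
apply: ler_sum => i _; apply: ler_wpM2r => //.
have -> : (m - l = (m - l.+1).+1)%N by lia.
have -> : (m - 2 * l + i = (m - 2 * l.+1 + i).+2)%N by lia.
by apply: sum_term_shift; lia.
Qed.

Lemma Ssum_le m l l' : (l <= l')%N -> (2 * l' < m)%N -> Ssum m l <= Ssum m l'.
Proof.
elim: l' => [|l' IHl]; first by case: l.
rewrite leq_eqVlt => /predU1P[-> //|le_ll'] lt_lm.
by apply: le_trans (Ssum_leS _ _ lt_lm); apply: IHl => //; lia.
Qed.

Lemma Ssum_maximal m l : (0 < m)%N -> l = ((m - 1) %/ 2)%N ->
  is_maximal_sum m (Ssum m l).
Proof.
move=> m0 ->; split; first by exists ((m - 1) %/ 2)%N.
by move=> l' le_l'; apply: Ssum_le => //; lia.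
Qed.

(** * Telescoping bounds for central binomial sums *)

Definition scaled_binom (r : nat) : rat := ('C(2 * r, r))%:R / 8%:R ^+ r.

Lemma scaled_binom_gt0 r : 0 < scaled_binom r.
Proof. by rewrite divr_gt0 ?exprn_gt0 // ltr0n bin_gt0; lia. Qed.

Lemma scaled_binomS r :
  scaled_binom r.+1 = (2%:R * r%:R + 1) / (4%:R * (r%:R + 1)) * scaled_binom r.
Proof.
rewrite /scaled_binom central_binSE exprS.
have : 8%:R ^+ r != 0 :> rat by rewrite expf_neq0.
by move: (8%:R ^+ r) => P nzP; field; rewrite nzP natr1 pnatr_eq0.
Qed.

Lemma scaled_binom0 : scaled_binom 0 = 1.
Proof. by rewrite /scaled_binom muln0 bin0 expr0 divr1. Qed.

Lemma scaled_binom1 : scaled_binom 1 = 4%:R^-1.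
Proof. by rewrite scaled_binomS scaled_binom0; field. Qed.

Lemma scaled_binom2 : scaled_binom 2 = 3%:R / 32%:R.
Proof. by rewrite scaled_binomS scaled_binom1; field. Qed.

(* Telescoping against (2r + 1) D(r), where D = scaled_binom and r = i + 1. *)
Lemma scaled_binom_sum_odd m :
  \sum_(i < m) scaled_binom i.+1 * i.+1%:R
    <= 3%:R / 4%:R - (2%:R * m%:R + 3%:R) * scaled_binom m.+1.
Proof.
elim: m => [|m IHm]; first by rewrite big_ord0 scaled_binom1; lra.
rewrite big_ord_recr /= (scaled_binomS m.+1); apply: le_trans (lerD IHm (lexx _)) _.
have D0 := scaled_binom_gt0 m.+1; move: (scaled_binom _) D0 => D D0.
have m0 : 0 <= m%:R :> rat by [].
rewrite -!natr1; move: (m%:R : rat) m0 => x x0.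
rewrite -subr_ge0.
have -> : 3%:R / 4%:R - (2%:R * (x + 1) + 3%:R)
    * ((2%:R * (x + 1) + 1) / (4%:R * (x + 1 + 1)) * D)
    - (3%:R / 4%:R - (2%:R * x + 3%:R) * D + D * (x + 1))
    = D / (4%:R * (x + 2%:R)) by field; lra.
by rewrite divr_ge0 ?ltW //; lra.
Qed.

(* Telescoping against 2r D(r), where D = scaled_binom and r = i + 2. *)
Lemma scaled_binom_sum_even m :
  \sum_(i < m) scaled_binom i.+2 * i.+1%:R
    <= 3%:R / 8%:R - 2%:R * (m%:R + 2%:R) * scaled_binom m.+2.
Proof.
elim: m => [|m IHm]; first by rewrite big_ord0 scaled_binom2; lra.
rewrite big_ord_recr /= (scaled_binomS m.+2); apply: le_trans (lerD IHm (lexx _)) _.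
have D0 := scaled_binom_gt0 m.+2; move: (scaled_binom _) D0 => D D0.
have m0 : 0 <= m%:R :> rat by [].
rewrite -!natr1; move: (m%:R : rat) m0 => x x0.
rewrite -subr_ge0.
have -> : 3%:R / 8%:R - 2%:R * (x + 1 + 2%:R)
    * ((2%:R * (x + 1 + 1) + 1) / (4%:R * (x + 1 + 1 + 1)) * D)
    - (3%:R / 8%:R - 2%:R * (x + 2%:R) * D + D * (x + 1))
    = D / 2%:R by field; lra.
by rewrite divr_ge0 ?ltW //; lra.
Qed.

Lemma sum_term_le m n r0 (K : rat) :
  (4 * n <= 2 * m + 3 * r0)%N -> bin_ratio n (2 * m) r0 <= K / 4%:R ^+ r0 ->
  forall r, (r0 <= r <= 2 * m)%N -> sum_term m n r <= K * scaled_binom r.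
Proof.
move=> le_n base r le_r.
have -> : K * scaled_binom r
    = ('C(2 * r, r))%:R / 2%:R ^+ r * (K / 4%:R ^+ r).
  (* The weight 2^-r and the decay 4^-r combine into 8^-r. *)
  rewrite /scaled_binom (_ : 8%:R = 2%:R * 4%:R :> rat) //.
  by rewrite exprMn invfM; ring.
by apply: ler_wpM2l; [rewrite divr_ge0 ?exprn_ge0 | exact: (bin_ratio_le _ _ _ _ le_n base r le_r)].
Qed.

(** * The largest sum is below 1, by parity of the first index *)

Lemma Ssum_odd_lt1 m : (0 < m)%N -> Ssum (2 * m - 1) (m - 1) < 1.
Proof.
move=> m0; rewrite SsumE; last by lia.
have -> : ((m - 1).+1 = m)%N by lia.
have -> : (2 * m - 1 - (m - 1) = m)%N by lia.
have -> : (2 * m - 1 - 2 * (m - 1) = 1)%N by lia.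
(* The bound m / (2 (2m - 1)) <= 1/3 used below needs m >= 2; for m = 1 the sum is a single explicit
   term. *)
have [-> |m_neq1] := eqVneq m 1%N.
  by rewrite big_ord1.
have le_sum : \sum_(i < m) sum_term (2 * m - 1) m (1 + i) * i.+1%:R
    <= \sum_(i < m) 4%:R / 3%:R * (scaled_binom i.+1 * i.+1%:R).
  apply: ler_sum => -[i lt_im] _; rewrite mulrA; apply: ler_wpM2r; first exact: ler0n.
  (* The decay condition 4 m <= 2 (2m - 1) + 3 r0 first holds at r0 = 1, where K = 4/3 makes K / 4 =
     1/3. *)
  apply: (@sum_term_le _ _ 1); [lia | | by rewrite /=; lia].
  rewrite bin_ratioS; last by lia.
  rewrite bin_ratio0 mul1r !subn0 expr1 ler_pdivrMr ?ltr0n; last by lia.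
  have le3 : (3 * m <= 2 * (2 * m - 1))%N by lia.
  have : (3 * m)%:R <= (2 * (2 * m - 1))%:R :> rat by rewrite ler_nat.
  by rewrite natrM; lra.
apply: le_lt_trans le_sum _; rewrite -mulr_sumr.
(* The constants cancel exactly, 4/3 * 3/4 = 1; strictness comes from the positive term subtracted
   in the telescoping bound. *)
have := scaled_binom_sum_odd m.
have : 0 < (2%:R * m%:R + 3%:R) * scaled_binom m.+1.
  by rewrite mulr_gt0 ?scaled_binom_gt0 // ltr_wpDl ?mulr_ge0.
lra.
Qed.

Lemma Ssum_even_lt1 m : (0 < m)%N -> Ssum (2 * m) (m - 1) < 1.
Proof.
move=> m0; rewrite SsumE; last by lia.
have -> : ((m - 1).+1 = m)%N by lia.
have -> : (2 * m - (m - 1) = m.+1)%N by lia.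
have -> : (2 * m - 2 * (m - 1) = 2)%N by lia.
have le_sum : \sum_(i < m) sum_term (2 * m) m.+1 (2 + i) * i.+1%:R
    <= \sum_(i < m) 8%:R / 3%:R * (scaled_binom i.+2 * i.+1%:R).
  apply: ler_sum => -[i lt_im] _; rewrite mulrA; apply: ler_wpM2r; first exact: ler0n.
  (* Here the decay condition 4 (m + 1) <= 4 m + 3 r0 first holds at r0 = 2, and K = 8/3 gives K /
     16 = 1/6, attained by the ratio at m = 1. Again 8/3 * 3/8 = 1. *)
  apply: (@sum_term_le _ _ 2); [lia | | by rewrite /=; lia].
  rewrite !bin_ratioS; [| lia..].
  rewrite bin_ratio0 mul1r !subn0 mulf_div -!natrM.
  rewrite ler_pdivrMr ?ltr0n; last by nia.
  have : (6 * (m.+1 * (m.+1 - 1)))%:R <= (2 * (2 * m) * (2 * (2 * m) - 1))%:R :> rat.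
    by rewrite ler_nat; nia.
  by rewrite natrM; lra.
apply: le_lt_trans le_sum _; rewrite -mulr_sumr.
have := scaled_binom_sum_even m.
have : 0 < 2%:R * (m%:R + 2%:R) * scaled_binom m.+2.
  by rewrite mulr_gt0 ?scaled_binom_gt0 // mulr_gt0 // ltr_wpDl.
lra.
Qed.

Theorem theorem1p4 (m : nat) (hm : (0 < m)%N) :
  [/\ (* the maximal sum is the one with the largest second index, and is < 1 *)
      is_maximal_sum m (Ssum m ((m - 1) %/ 2)) /\ Ssum m ((m - 1) %/ 2) < 1,
      (* even first index 2m *)
      is_maximal_sum (2 * m) (Tsum m) /\
      Tsum m = \sum_(2 <= r < m.+2)
              ('C(2 * r, r))%:R * ('C(m + 1, r))%:R
                * ((r - 1)%:R / (2%:R ^+ r * ('C(4 * m, r))%:R)) &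
      (* odd first index 2m-1 *)
      is_maximal_sum (2 * m - 1) (Ssum (2 * m - 1) (m - 1)) /\
      Ssum (2 * m - 1) (m - 1)
        = \sum_(1 <= r < m.+1)
              ('C(2 * r, r))%:R * ('C(m, r))%:R
                * (r%:R / (2%:R ^+ r * ('C(4 * m - 2, r))%:R))].
Proof.
split; split.
- exact: Ssum_maximal.
(* Odd m is 2 m' - 1 with m' = [m./2 + 1], even m is 2 m' with m' = [m./2]; in both cases the
   largest second index is m' - 1. *)
- have := odd_double_half m; case: (odd m) => /= mE.
    have -> : ((m - 1) %/ 2 = (m./2).+1 - 1)%N by lia.
    have {1}-> : (m = 2 * (m./2).+1 - 1)%N by lia.
    exact: Ssum_odd_lt1.
  have -> : ((m - 1) %/ 2 = m./2 - 1)%N by lia.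
  have {1}-> : (m = 2 * m./2)%N by lia.
  by apply: Ssum_even_lt1; lia.
- by apply: Ssum_maximal; lia.
- rewrite /Tsum SsumE; last by lia.
  rewrite (@big_addn _ _ _ 0 _ 2) big_mkord.
  have -> : (m.+2 - 2 = m)%N by lia.
  have -> : ((m - 1).+1 = m)%N by lia.
  have -> : (2 * m - (m - 1) = m + 1)%N by lia.
  have -> : (2 * m - 2 * (m - 1) = 2)%N by lia.
  apply: eq_bigr => i _; rewrite [(2 + i)%N]addnC.
  have -> : (4 * m = 2 * (2 * m))%N by lia.
  have -> : (i + 2 - 1 = i.+1)%N by lia.
  by rewrite /sum_term /bin_ratio invfM; ring.
- by apply: Ssum_maximal; lia.
- rewrite SsumE; last by lia.
  rewrite (@big_addn _ _ _ 0 _ 1) big_mkord.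
  have -> : (m.+1 - 1 = m)%N by lia.
  have -> : ((m - 1).+1 = m)%N by lia.
  have -> : (2 * m - 1 - (m - 1) = m)%N by lia.
  have -> : (2 * m - 1 - 2 * (m - 1) = 1)%N by lia.
  apply: eq_bigr => i _; rewrite addnC addn1.
  have -> : (4 * m - 2 = 2 * (2 * m - 1))%N by lia.
  by rewrite /sum_term /bin_ratio invfM; ring.
Qed.
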